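(* Let $G$ be a bipartite chordal graph. (a) The generic completion rank of $G$ is the largest integer $r$ such that $G$ contains $K_{r,r}$ as an induced subgraph. (b) The only typical completion rank of $G$ is its generic completion rank. (c) Let $\mathbb{K}=\mathbb{R}$ or $\mathbb{C}$. Every $G$-partial matrix $M$ over $\mathbb{K}$ whose completely specified minors are all nonzero has a completion over $\mathbb{K}$ of rank $\operatorname{gcr}(G)$.
   Context: A bipartite graph $G=(R\cup C,E)$ is finite, with parts $R$ (of size $m$) and $C$ (of size $n$) and edge set $E\subseteq R\times C$. It is bipartite chordal if every induced cycle of $G$ has length $4$. $K_{r,r}$ is the complete bipartite graph with both parts of size $r$ (for $r=0$, the empty graph). For a field $K$, a $G$-partial matrix over $K$ is a vector $M=(M_{ij})_{(i,j)\in E}\in K^E$. A completion of $M$ over $K$ is an $m\times n$ matrix $A$ with entries in $K$, rows indexed by $R$ and columns indexed by $C$, with $A_{ij}=M_{ij}$ for all $(i,j)\in E$. The $K$-completion rank of $M$ is the smallest rank of a completion of $M$ over $K$; for $K=\mathbb{R}$ (resp. $\mathbb{C}$) it is called the real (resp. complex) completion rank. The generic completion rank $\operatorname{gcr}(G)$ is the unique integer $r$ such that all $M$ in some nonempty Zariski-open subset of $\mathbb{C}^E$ have complex completion rank $r$. An integer $r$ is a typical completion rank of $G$ if the set of $M\in\mathbb{R}^E$ with real completion rank $r$ has nonempty interior in the Euclidean topology. A completely specified minor of $M$ is the determinant of a square submatrix (of any size) with row set $A\subseteq R$ and column set $B\subseteq C$, $|A|=|B|$, such that $A\times B\subseteq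 E$. *)

(* Defs.v *)
From HB Require Import structures.
From mathcomp Require Import all_boot all_order all_algebra.
From mathcomp Require Import all_classical all_reals all_analysis.
From mathcomp Require Import complex.
(* not imported: its notations clash with those of mathcomp-analysis *)
From mathcomp Require mpoly.

Set Implicit Arguments.
Unset Strict Implicit.
Unset Printing Implicit Defensive.

Import Order.TTheory GRing.Theory Num.Theory.
Import numFieldNormedType.Exports.

Local Open Scope classical_set_scope.
Local Open Scope ring_scope.

(* A bipartite graph with parts of sizes m and n, given by its set of edges. *)
Notation bigraph m n := {set 'I_m * 'I_n}.

Section Graphs.
Variables m n : nat.
Implicit Type G : bigraph m n.

Definition adj G : rel ('I_m + 'I_n) := fun x y =>
  match x, y with
  | inl i, inr j | inr j, inl i => (i, j) \in G
  | _, _ => false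
  end.

(* The cyclic sequence c of distinct vertices is a cycle of e without chord. *)
Definition induced_cycle (T : eqType) (e : rel T) (c : seq T) : Prop :=
  [/\ ucycle e c, (2 < size c)%N &
      {in c &, forall x y, e x y -> (y == next c x) || (x == next c y)}].

Definition bipartite_chordal G : Prop :=
  forall c, induced_cycle (adj G) c -> size c = 4.

End Graphs.

Definition biclique r : bigraph r r := [set: 'I_r * 'I_r].

Definition contains_induced m n r s (G : bigraph m n) (H : bigraph r s) : Prop :=
  exists2 f : 'I_r + 'I_s -> 'I_m + 'I_n,
    injective f & forall x y, adj G (f x) (f y) = adj H x y.

Definition largest_biclique m n (G : bigraph m n) (r : nat) : Prop :=
  contains_induced G (biclique r) /\
  forall s, contains_induced G (biclique s) -> (s <= r)%N.

(* The space K^E of G-partial matrices over K: the k-th coordinate is the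
   entry at the k-th edge [enum_val k]. *)
Definition pmatrix m n (G : bigraph m n) (K : Type) := 'rV[K]_(#|G|).

Section PartialMatrices.
Variables (K : fieldType) (m n : nat) (G : bigraph m n).
Implicit Type M : pmatrix G K.

(* The value 0 outside of G is junk. *)
Definition entry M (i : 'I_m) (j : 'I_n) : K :=
  if [pick k : 'I_(#|G|) | enum_val k == (i, j)] is Some k then M 0 k else 0.

Definition completion M (A : 'M[K]_(m, n)) : Prop :=
  forall i j, (i, j) \in G -> A i j = entry M i j.

Definition completion_rank M (r : nat) : Prop :=
  (exists2 A, completion M A & \rank A = r) /\
  forall A, completion M A -> (r <= \rank A)%N.

(* Rows and columns are taken in increasing order. *)
Definition minor M (A : {set 'I_m}) (B : {set 'I_n}) (eqAB : #|A| = #|B|) : K :=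
  \det (\matrix_(i < #|A|, j < #|A|)
          entry M (enum_val i) (enum_val (cast_ord eqAB j))).

Definition specified_minors_nonzero M : Prop :=
  forall (A : {set 'I_m}) (B : {set 'I_n}) (eqAB : #|A| = #|B|),
    finset.setX A B \subset G -> minor M eqAB != 0.

End PartialMatrices.

Definition zariski_open (K : fieldType) (d : nat) (U : set 'rV[K]_d) : Prop :=
  exists S : set (mpoly.mpoly d K),
    U = [set v : 'rV[K]_d | exists2 p, S p & mpoly.meval (fun i => v 0 i) p != 0].

Section Ranks.
Variables (R : realType) (m n : nat) (G : bigraph m n).

Definition generic_completion_rank (r : nat) : Prop :=
  exists U : set (pmatrix G R[i]),
    [/\ zariski_open U, U !=set0 & forall M, U M -> completion_rank M r].

Definition typical_completion_rank (r : nat) : Prop :=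
  interior [set M : 'rV[R]_(#|G|) | completion_rank (G := G) M r] !=set0.

End Ranks.

(* Main.v *)
Require Import Defs.
From mathcomp Require Import all_boot all_order all_algebra.
From mathcomp Require Import all_classical all_reals all_analysis.
From mathcomp Require Import complex.
From mathcomp Require Import zify.

(** Let r be the largest size of a balanced biclique of G.  Everything follows
    from one fact, [chordal_factorization]: over any field, a partial matrix on
    a bipartite chordal graph whose specified minors are all nonzero is
    completed by a product X *m Y with r columns in X.  A completion has rank
    at least r because it contains a nonsingular r x r specified block, so every
    such partial matrix has completion rank exactly r
    ([chordal_completion_rank]), which is (c).

    The factorization is built by induction on the edges.  A bipartite chordal
    graph with an edge has a bisimplicial edge (v, w): all neighbors of w are
    adjacent to all neighbors of v ([bisimplicial_edge]).  Suppose that w has a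
    neighbors and v has b.  If a < b, delete column w: the rows next to w still
    meet a specified a x a block, so their vectors in X are independent and a
    vector for w with the prescribed products exists, within the same rank.  If
    a > b, delete row v instead.  If a = b, delete both: what remains of the
    biclique has size a - 1 < r, so there is a direction orthogonal to it in
    which the product of the vectors of v and w can be adjusted
    ([solve_corner]).

    The bisimplicial edge is found in the style of Dirac's lemma on simplicial
    vertices, by proving more: if some column with a neighbor is not adjacent
    to row x, then a bisimplicial edge exists whose column is not adjacent to x
    ([bisimplicial_away]).  In a component of the graph without the columns of
    x, chordality gives a row y adjacent to all the columns of x that the
    component touches ([comp_dominant]); the induction then continues either
    inside the component with y for x, or after removing y.

    For (a) and (b), the product of the specified minors is a polynomial which
    is not identically zero.  Restricted to the line through two points, a
    polynomial nonzero at one of them has finitely many roots.  Hence two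
    nonempty Zariski-open sets meet, which makes the generic rank unique, and
    the nonvanishing set is dense, besides open, in the Euclidean topology,
    which excludes all other typical ranks. *)

Set Implicit Arguments.
Unset Strict Implicit.
Unset Printing Implicit Defensive.

Import Order.TTheory GRing.Theory Num.Theory.
Import numFieldNormedType.Exports.

Local Open Scope ring_scope.

(** * Shortest paths and induced cycles *)

Section Cycle.
Variables (T : eqType).

Lemma next_nth_lt (c : seq T) x0 k : uniq c -> (k.+1 < size c)%N ->
  next c (nth x0 c k) = nth x0 c k.+1.
Proof.
move=> cu ks; have k1 := ltnW ks.
rewrite next_nth mem_nth // index_uniq //.
case: c cu ks k1 => //= y p cu ks _; exact: set_nth_default.
Qed.

Lemma next_last (x : T) p : uniq (x :: p) -> next (x :: p) (last x p) = x.
Proof.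
move=> cu; rewrite next_nth mem_last -[last x p](nth_last x (x :: p)) index_uniq//=.
by rewrite nth_default.
Qed.

(** The path is chordless because it is shortest: a chord from position i to a
    position j > i + 1 would skip the vertices in between. *)
Lemma shortest_path (e : rel T) (D : pred T) s t p :
    path e s p -> last s p = t -> all D p ->
  exists q, [/\ path e s q, last s q = t, all D q, uniq (s :: q) &
    forall i j, (i < j <= size q)%N ->
      e (nth s (s :: q) i) (nth s (s :: q) j) -> j = i.+1].
Proof.
move=> pp lp Dp.
pose P n := `[< exists p, [/\ path e s p, last s p = t, all D p & size p = n] >].
have exP : exists n, P n by exists (size p); apply/asboolP; exists p.
case: (ex_minnP exP) => n /asboolP[p0 [pp0 lp0 Dp0 sp0]] nmin.
have [q qp0 [pq lq uq]] : exists2 q, {subset q <= p0} &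
    [/\ path e s q, last s q = t & uniq (s :: q)].
  move: lp0; case/shortenP: pp0 => q pq uq sq lq; exists q => //.
have Dq : all D q by apply/allP => u /qp0; apply: (allP Dp0).
exists q; split => // i j /andP[ij jq] eij.
have sq : (size q <= n)%N.
  by rewrite -sp0; apply: uniq_leq_size => //; case/andP: uq.
have jE : j = j.-1.+1 by rewrite prednK//; apply: leq_trans ij.
have j1q : (j.-1 < size q)%N by rewrite -jE.
(* following the chord gives a path of this length *)
suff: P (i + (size q - j.-1))%N by move=> /nmin; lia.
apply/asboolP; exists (take i q ++ drop j.-1 q); split.
- rewrite cat_path take_path//= (drop_nth s)//=.
  have -> : last s (take i q) = nth s (s :: q) i.
    have iq : (i <= size q)%N by lia.
    by rewrite (last_nth s) size_takel //; case: (i) => //= k; rewrite nth_take.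
  rewrite {1}jE /= in eij; rewrite eij /=.
  have := pq; rewrite -{1}(cat_take_drop j.-1 q) cat_path (drop_nth s)//= => /and3P[_ _].
  by rewrite -jE.
- by rewrite last_cat (drop_nth s) //= -lq -[in RHS](cat_take_drop j.-1 q)
    last_cat (drop_nth s j1q).
- rewrite all_cat; apply/andP; split; apply/allP => u.
    by move/mem_take; apply: (allP Dq).
  by move/mem_drop; apply: (allP Dq).
- by rewrite size_cat size_drop size_takel //; lia.
Qed.

(** A shortest path from s to t inside D closes up through x into an induced
    cycle, which must be a square: its fourth vertex is the common neighbor. *)
Lemma chordal_shortcut (e : rel T) (D : pred T) x s t p :
    symmetric e -> irreflexive e ->
    (forall c, induced_cycle e c -> size c = 4) ->
    (forall d, D d -> d != x /\ ~~ e x d) ->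
    e x s -> e x t -> s != t -> ~~ e s t ->
    path e s (rcons p t) -> all D p ->
  exists u, [/\ D u, e s u & e u t].
Proof.
move=> esym eirr chord Dx exs ext st nst pp Dp.
(* s is not in this set, so a minimal path meets the neighbors of x only at
   its two ends *)
have [|||q [pq lq Dq uq qmin]] := @shortest_path e (predU1 t D) s t (rcons p t) => //.
- by rewrite last_rcons.
- rewrite all_rcons /= eqxx /=; apply/allP => u /(allP Dp) /= ->; exact: orbT.
have q0 : (0 < size q)%N by case: (q) lq st => //= ->; rewrite eqxx.
have xc : uniq [:: x, s & q].
  rewrite cons_uniq uq andbT inE negb_or; apply/andP; split.
    by apply: contraTneq exs => ->; rewrite eirr.
  apply/negP => /(allP Dq) /= /predU1P[xt|/Dx[/eqP//]].
  by move: ext; rewrite xt eirr.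
have xcyc : cycle e [:: x, s & q].
  by rewrite /= exs rcons_path pq /= lq esym.
have chordx k : (k < size (s :: q))%N -> e x (nth s (s :: q) k) ->
    nth s (s :: q) k = next [:: x, s & q] x \/ x = next [:: x, s & q] (nth s (s :: q) k).
  case: k => [|k] ks ek; first by left; rewrite /= eqxx.
  have kt : nth s q k = t.
    have /(allP Dq) /= : nth s q k \in q by exact: mem_nth.
    by move=> /predU1P[//|/Dx[_ /negP]]; case.
  by right; rewrite /= kt -lq; have /= -> := next_last xc.
have ordered i j : (i < j <= size q)%N -> e (nth s (s :: q) i) (nth s (s :: q) j) ->
    nth s (s :: q) j = next [:: x, s & q] (nth s (s :: q) i).
  move=> ij /(qmin _ _ ij) jE; subst j.
  have := @next_nth_lt [:: x, s & q] s i.+1 xc; rewrite /= => -> //.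
  by case/andP: ij.
have sz : size [:: x, s & q] = 4.
  apply: chord; split => //; first by rewrite /ucycle xcyc.
  have chordC i j : (i < j < size [:: x, s & q])%N ->
      e (nth s [:: x, s & q] i) (nth s [:: x, s & q] j) ->
      (nth s [:: x, s & q] j == next [:: x, s & q] (nth s [:: x, s & q] i)) ||
      (nth s [:: x, s & q] i == next [:: x, s & q] (nth s [:: x, s & q] j)).
    case: i j => [|i] [|j] //= ij eij.
      by case: (chordx j ij eij) => /= <-; rewrite eqxx ?orbT.
    by have /= <- := ordered i j ij eij; rewrite eqxx.
  have sym a b : a \in [:: x, s & q] -> b \in [:: x, s & q] -> e a b ->
     (index a [:: x, s & q] < index b [:: x, s & q])%N ->
     (b == next [:: x, s & q] a) || (a == next [:: x, s & q] b).
    move=> ac bc eab ab.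
    have := @chordC (index a [:: x, s & q]) (index b [:: x, s & q]).
    by rewrite ab index_mem !nth_index // => /(_ bc eab).
  move=> a b ac bc eab.
  case: (ltngtP (index a [:: x, s & q]) (index b [:: x, s & q])) => [ab|ba|ab].
  - exact: sym.
  - by rewrite orbC; apply: sym => //; rewrite esym.
  - by move: eab; rewrite -(nth_index s ac) ab nth_index// eirr.
case: q pq lq Dq uq {q0 qmin chordx ordered xc xcyc} sz => [|u [|v [|]]]//=.
move=> /and3P[esu euv _] vt /and3P[Du _ _] uu _; subst v; exists u; split=> //.
case/predU1P: Du => // ut; by rewrite ut !inE eqxx andbF in uu.
Qed.
End Cycle.

(** * Bisimplicial edges *)

Lemma adj_sym m n (G : bigraph m n) : symmetric (adj G).
Proof. by case=> i [] j. Qed.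

Lemma adj_irr m n (G : bigraph m n) : irreflexive (adj G).
Proof. by case. Qed.

Section Bisimplicial.
Variables (m n : nat) (G : bigraph m n).
Hypothesis chordalG : bipartite_chordal G.

(** Between its ends the path t - u - s - z - t' avoids y and its neighbors, so u,
    s or z would be a common neighbor of t and t'. *)
Lemma no_hexagon (y u z : 'I_m) (t s t' : 'I_n) :
  (y, t) \in G -> (y, t') \in G -> (u, t) \in G -> (u, s) \in G ->
  (z, s) \in G -> (z, t') \in G ->
  (y, s) \notin G -> (u, t') \notin G -> (z, t) \notin G -> False.
Proof.
move=> yt yt' ut us zs zt' ys ut' zt.
have /= := @chordal_shortcut _ (adj G) (mem [:: inl u; inr s; inl z]) (inl y)
  (inr t) (inr t') [:: inl u; inr s; inl z] (@adj_sym _ _ G) (@adj_irr _ _ G) chordalG.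
rewrite /= yt yt' ut us zs zt' !inE !eqxx !orbT /=; case => //.
- move=> d; rewrite !inE => /or3P[] /eqP-> //=; split=> //.
    by apply: contraNneq ys => -[<-].
  by apply: contraNneq ys => -[<-].
- by apply: contraNneq ut' => -[<-].
- move=> d; rewrite !inE => -[/or3P[] /eqP-> //=].
    by rewrite (negPf ut').
  by rewrite (negPf zt).
Qed.

Section Component.
Variables (Rs : {set 'I_m}) (x : 'I_m) (v0 : 'I_m).

(** The vertices away from x.  Row x has no neighbor among them, but it is left
    out because the path in [chordal_shortcut] must avoid it. *)
Definition far (a : 'I_m + 'I_n) : bool :=
  match a with inl i => (i \in Rs) && (i != x) | inr c => (x, c) \notin G end.

Definition far_adj : rel ('I_m + 'I_n) := fun a b => [&& far a, far b & adj G a b].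

Definition comp : {set 'I_m} := [set i | connect far_adj (inl v0) (inl i)].

Hypothesis far_v0 : far (inl v0).

Lemma far_adj_sym : connect_sym far_adj.
Proof.
by apply: sym_connect_sym => a b; rewrite /far_adj andbCA adj_sym.
Qed.

Lemma comp_far a : connect far_adj (inl v0) a -> far a.
Proof.
case/connectP => p; elim/last_ind: p => [|p b _]; first by move=> _ ->.
by rewrite rcons_path last_rcons => /andP[_ /and3P[_ fb _]] ->.
Qed.

Lemma comp_row i : i \in comp -> i \in Rs /\ i != x.
Proof. by rewrite inE => /comp_far /andP. Qed.

Lemma v0_comp : v0 \in comp. Proof. by rewrite inE. Qed.

Lemma comp_closed i i' c : i \in comp -> (i, c) \in G -> (x, c) \notin G ->
  i' \in Rs -> (i', c) \in G -> i' \in comp.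
Proof.
move=> iC ic xc i'R i'c; move: (iC); rewrite !inE => vi.
apply: (connect_trans vi); apply: (@connect_trans _ _ (inr c)).
  by apply: connect1; rewrite /far_adj (comp_far vi) /= xc ic.
apply: connect1; rewrite /far_adj /= xc i'R i'c !andbT /=.
by apply: contraNneq xc => <-.
Qed.

(** The rows i and i' are joined inside the component, and x is adjacent to no
    column of the component. *)
Lemma comp_common i i' s t : i \in comp -> i' \in comp ->
  (i, s) \in G -> (i', t) \in G -> (x, s) \in G -> (x, t) \in G ->
  exists u, [/\ u \in comp, (u, s) \in G & (u, t) \in G].
Proof.
move=> iC i'C is_ it xs xt.
have [->|st] := eqVneq s t; first by exists i'.
have [vi vi'] : connect far_adj (inl v0) (inl i) /\ connect far_adj (inl v0) (inl i').
  by move: iC i'C; rewrite !inE.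
have : connect far_adj (inl i) (inl i').
  by apply: connect_trans vi'; rewrite far_adj_sym.
case/connectP => p pp lp.
have sub : subrel far_adj (adj G) by move=> a b /and3P[].
have := @chordal_shortcut _ (adj G) (connect far_adj (inl v0)) (inl x)
  (inr s) (inr t) (inl i :: p) (@adj_sym _ _ G) (@adj_irr _ _ G) chordalG.
case=> //.
- by move=> d /comp_far; case: d => /= [k /andP[_ kx]|c ->].
- by rewrite /= is_ rcons_path (sub_path sub pp) -lp.
- apply/allP => a ap; apply: (connect_trans vi).
  exact: (path_connect pp).
- by case=> [u|c] [] // Du us ut; exists u; rewrite inE.
Qed.

(** A Helly-type argument.  The row y has as many columns of x as possible.  If
    it missed a column s, take z containing s and sharing as much as possible
    with y among the columns of x; maximality of y and of z together with
    [comp_common] then produce an induced hexagon. *)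
Lemma comp_dominant : exists2 y, y \in comp &
  forall i s, i \in comp -> (i, s) \in G -> (x, s) \in G -> (y, s) \in G.
Proof.
pose S i := [set s | ((i, s) \in G) && ((x, s) \in G)].
case: (@arg_maxnP _ v0 (mem comp) (fun i => #|S i|)) => [|y yC ymax]; first exact: v0_comp.
exists y => // i s iC is_ xs; apply: contraT => ys.
pose P k := (k \in comp) && ((k, s) \in G).
case: (@arg_maxnP _ i P (fun k => #|S k :&: S y|)) => [|z /andP[zC zs] zmax].
  by rewrite /P iC.
have [t yt zt] : exists2 t, t \in S y & t \notin S z.
  apply/subsetPn; apply/negP => sub.
  have : S y \proper S z.
    by apply/properP; split=> //; exists s; rewrite !inE ?zs ?xs // negb_and ys.
  by move/proper_card; rewrite ltnNge; move/negP; apply; exact: ymax.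
move: (yt) (zt); rewrite !inE => /andP[yt1 xt]; rewrite xt andbT => zt1.
have [u [uC us ut]] := comp_common zC yC zs yt1 xs xt.
have [t' zt' ut'] : exists2 t', t' \in S z :&: S y & t' \notin S u :&: S y.
  apply/subsetPn; apply/negP => sub.
  have : S z :&: S y \proper S u :&: S y.
    apply/properP; split=> //; exists t; rewrite !inE ?ut ?xt ?yt1 //.
    by rewrite (negPf zt1).
  move/proper_card; rewrite ltnNge; move/negP; apply; apply: zmax.
  by rewrite /P uC.
move: zt' ut'; rewrite !inE => /andP[/andP[zt'1 ->] /andP[yt'1 _]].
by rewrite yt'1 !andbT => ut'; case: (no_hexagon yt1 yt'1 ut us zs zt'1 ys ut' zt1).
Qed.
End Component.

(** Induction on the row set Rs, within which the edge is bisimplicial.  The row x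
    plays the part of the vertex to be avoided in Dirac's lemma. *)
Lemma bisimplicial_away (Rs : {set 'I_m}) x v0 w0 : x \in Rs -> v0 \in Rs ->
    (v0, w0) \in G -> (x, w0) \notin G ->
  exists v w, [/\ v \in Rs, (v, w) \in G, (x, w) \notin G &
    forall i, i \in Rs -> (i, w) \in G -> forall j, (v, j) \in G -> (i, j) \in G].
Proof.
have [N] := ubnP #|Rs|; elim: N Rs x v0 w0 => // N IH Rs x v0 w0 sR xR v0R v0w0 xw0.
have v0x : v0 != x by apply: contraNneq xw0 => <-.
have fv0 : far Rs x (inl v0) by rewrite /= v0R.
pose C := comp Rs x v0.
have sCR : C \proper Rs.
  apply/properP; split; first by apply/fintype.subsetP => i /(comp_row fv0)[].
  by exists x => //; apply/negP => /(comp_row fv0)[_]; rewrite eqxx.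
have [y yC ydom] := comp_dominant fv0; have [yR yx] := comp_row fv0 yC.
have v0C : v0 \in C := v0_comp Rs x v0.
have [[i [c [iC ic xc yc]]]|full] := pselect (exists i c, [/\ i \in C, (i, c) \in G,
    (x, c) \notin G & (y, c) \notin G]).
  (* rows of Rs outside C do not meet the columns of C that are far from x, so an edge
     bisimplicial within C is so within Rs *)
  have [|v [w [vC vw yw vdom]]] := IH C y i c _ yC iC ic yc.
    by apply: leq_trans (proper_card sCR) _.
  have xw : (x, w) \notin G by apply: contra yw; exact: ydom vw.
  exists v, w; split=> //; first by case: (comp_row fv0 vC).
  by move=> k kR kw; apply: vdom => //; exact: comp_closed vC vw xw kR kw.
(* otherwise row y contains every row of C, and can be removed *)
have Ny k c : k \in C -> (k, c) \in G -> (y, c) \in G.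
  move=> kC kc; have [xc|xc] := boolP ((x, c) \in G); first exact: ydom kC kc xc.
  by apply: contraT => yc; case: full; exists k, c.
have [[v1 [w1 [v1R v1y v1w1 xw1]]]|only] := pselect (exists v1 w1,
    [/\ v1 \in Rs, v1 != y, (v1, w1) \in G & (x, w1) \notin G]).
  have [|||v [w [vR vw xw vdom]]] := IH (Rs :\ y) x v1 w1 _ _ _ v1w1 xw1.
  - by rewrite (cardsD1 y) yR in sR.
  - by rewrite !inE eq_sym yx.
  - by rewrite !inE v1y.
  have {}vR : v \in Rs by move: vR; rewrite !inE => /andP[].
  exists v, w; split=> // k kR kw j vj.
  have [ky|ky] := eqVneq k y; last by apply: (vdom k) => //; rewrite !inE ky.
  rewrite ky in kw *; apply: (Ny v) => //.
  exact: comp_closed yC kw xw vR vw.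
(* here y is the only row of Rs meeting w0 *)
exists y, w0; split=> //; first exact: Ny v0C v0w0.
move=> k kR kw0 j yj; have [->//|ky] := eqVneq k y.
by case: only; exists k, w0.
Qed.

Lemma bisimplicial_edge e : e \in G -> exists v w, (v, w) \in G /\
  forall i j, (i, w) \in G -> (v, j) \in G -> (i, j) \in G.
Proof.
case: e => v w vw.
have [[x [v0 [w0 [v0w0 xw0]]]]|full] := pselect (exists x v0 w0,
    (v0, w0) \in G /\ (x, w0) \notin G).
  have [v1 [w1 [_ v1w1 _ dom]]] :=
    bisimplicial_away (finset.in_setT x) (finset.in_setT v0) v0w0 xw0.
  by exists v1, w1; split=> // i j iw1; apply: dom => //; rewrite finset.in_setT.
exists v, w; split=> // i j iw vj; apply: contraT => ij.
by case: full; exists i, v, j.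
Qed.

End Bisimplicial.

(** * Completion by factorization *)

Section Restrict.
Variables (m n : nat) (G : bigraph m n) (A : {set 'I_m}) (B : {set 'I_n}).

Definition restrict : bigraph m n := G :&: finset.setX A B.

Lemma in_restrict i j : ((i, j) \in restrict) = [&& (i, j) \in G, i \in A & j \in B].
Proof. by rewrite !inE. Qed.

Lemma chordal_restrict : bipartite_chordal G -> bipartite_chordal restrict.
Proof.
move=> chordalG c [/andP[cyc uc] sc chord]; apply: chordalG.
pose alive (a : 'I_m + 'I_n) := match a with inl i => i \in A | inr j => j \in B end.
have adjE a b : adj restrict a b = [&& adj G a b, alive a & alive b].
  by case: a b => [i|j] [i'|j'] //=; rewrite in_restrict // [(j \in B) && _]andbC.
have c_alive a : a \in c -> alive a.
  by move=> ac; have := next_cycle cyc ac; rewrite adjE => /and3P[].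
split=> //.
  apply/andP; split=> //; apply: sub_cycle cyc => a b; rewrite adjE => /andP[].
  by [].
by move=> a b ac bc ab; apply: chord => //; rewrite adjE ab !c_alive.
Qed.
End Restrict.

Lemma col_mulmx (K : pzSemiRingType) p q s (A : 'M[K]_(p, q)) (B : 'M[K]_(q, s)) j :
  col j (A *m B) = A *m col j B.
Proof. by rewrite !colE mulmxA. Qed.

Section Bordering.
Variables (K : fieldType) (k r : nat) (P : 'M[K]_(k, r)) (Q : 'M[K]_(r, k)).
Hypothesis PQ_unit : P *m Q \in unitmx.

Lemma solve_col p (a : 'M[K]_(k, p)) : exists y, P *m y = a.
Proof. by exists (Q *m (invmx (P *m Q) *m a)); rewrite mulmxA mulKVmx. Qed.

Lemma solve_row p (b : 'M[K]_(p, k)) : exists x, x *m Q = b.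
Proof. by exists (b *m invmx (P *m Q) *m P); rewrite -mulmxA mulmxKV. Qed.

(** Z projects K^r onto the kernel of P along the columns of Q, and k < r makes
    it nonzero.  Adding a column of Z to y and a multiple of a row of Z to x
    changes neither P *m y nor x *m Q, while x *m y takes any value. *)
Lemma solve_corner (a : 'cV[K]_k) (b : 'rV[K]_k) c : (k < r)%N ->
  exists x y, [/\ P *m y = a, x *m Q = b & x *m y = c%:M].
Proof.
move=> kr; pose Z := 1%:M - Q *m invmx (P *m Q) *m P.
have PZ : P *m Z = 0 by rewrite mulmxBr mulmx1 !mulmxA mulmxV // mul1mx subrr.
have ZQ : Z *m Q = 0.
  by rewrite mulmxBl mul1mx -!mulmxA mulVmx // mulmx1 subrr.
have ZZ : Z *m Z = Z by rewrite {1}/Z mulmxBl mul1mx -!mulmxA PZ !mulmx0 subr0.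
have : Z != 0.
  rewrite subr_eq0; apply: contraTneq kr => Z0; rewrite -leqNgt -(mxrank1 K r) Z0.
  by rewrite -mulmxA; apply: leq_trans (mxrankM_maxl _ _) (rank_leq_col _).
case/matrix0Pn => i [j Zij].
pose y := Q *m (invmx (P *m Q) *m a) + col j Z.
pose x0 := b *m invmx (P *m Q) *m P.
have x0Q : x0 *m Q = b by rewrite -mulmxA mulmxKV.
have rZy : row i Z *m y = (Z i j)%:M.
  rewrite mulmxDr mulmxA -row_mul ZQ row0 mul0mx add0r -row_mul -[col j Z]mulmx1.
  by rewrite colE mulmx1 mulmxA ZZ -colE; apply/matrixP => u v; rewrite !ord1 !mxE.
exists (x0 + ((c - (x0 *m y) 0 0) / Z i j) *: row i Z), y; split.
- by rewrite mulmxDr -col_mulmx PZ mulmxA mulKVmx // col0 addr0.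
- by rewrite mulmxDl x0Q -scalemxAl -row_mul ZQ row0 scaler0 addr0.
rewrite mulmxDl -scalemxAl rZy [X in X + _]mx11_scalar scale_scalar_mx -raddfD /=.
by rewrite divfK // addrC subrK.
Qed.
End Bordering.

Definition submatrix (T : Type) m n (M : 'M[T]_(m, n))
    (A : {set 'I_m}) (B : {set 'I_n}) (eqAB : #|A| = #|B|) : 'M[T]_#|A| :=
  \matrix_(i, j) M (enum_val i) (enum_val (cast_ord eqAB j)).

Section Factorization.
Variables (K : fieldType) (m n r : nat).
Implicit Types (M : 'M[K]_(m, n)) (G : bigraph m n) (X : 'M[K]_(m, r)) (Y : 'M[K]_(r, n)).

Definition generic_on G M := forall (A : {set 'I_m}) (B : {set 'I_n}) (eqAB : #|A| = #|B|),
  finset.setX A B \subset G -> \det (submatrix M eqAB) != 0.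

Definition factors_on G M X Y := forall i j, (i, j) \in G -> (X *m Y) i j = M i j.

Lemma mulmx_rowcol X Y i j : (X *m Y) i j = (row i X *m col j Y) 0 0.
Proof. by rewrite !mxE; apply: eq_bigr => k _; rewrite !mxE. Qed.

Definition with_row X v (x : 'rV[K]_r) : 'M[K]_(m, r) := \matrix_i (if i == v then x else row i X).
Definition with_col Y w (y : 'cV[K]_r) : 'M[K]_(r, n) :=
  \matrix_(k, j) (if j == w then y else col j Y) k 0.

Lemma row_with_row X v x i : row i (with_row X v x) = if i == v then x else row i X.
Proof. exact: rowK. Qed.

Lemma col_with_col Y w y j : col j (with_col Y w y) = if j == w then y else col j Y.
Proof. by apply/matrixP => k l; rewrite !ord1 !mxE. Qed.

Section Block.
Variables (G : bigraph m n) (M : 'M[K]_(m, n)) (X : 'M[K]_(m, r)) (Y : 'M[K]_(r, n)).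
Variables (A : {set 'I_m}) (B : {set 'I_n}) (eqAB : #|A| = #|B|).
Hypotheses (XY : factors_on G M X Y) (ABG : finset.setX A B \subset G).
Hypothesis genM : generic_on G M.

Let P := rowsub (@enum_val _ (mem A)) X.
Let Q := colsub (fun j => enum_val (cast_ord eqAB j)) Y.

(** P and Q hold the vectors of the rows in A and of the columns in B, so their
    product is a specified block of M. *)
Lemma block_unit : P *m Q \in unitmx.
Proof.
rewrite unitmxE unitfE.
suff -> : P *m Q = submatrix M eqAB by exact: genM.
apply/matrixP => i j; rewrite mul_rowsub_mx mulmx_colsub !mxE -XY ?mxE //.
by apply: (fintype.subsetP ABG); rewrite inE !enum_valP.
Qed.

Lemma col_agrees (y : 'cV[K]_r) (a : 'cV[K]_m) :
  P *m y = rowsub (@enum_val _ (mem A)) a -> forall i, i \in A -> (row i X *m y) 0 0 = a i 0.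
Proof.
move=> + i iA => /(congr1 (row (enum_rank_in iA i))).
by rewrite row_mul !row_rowsub !enum_rankK_in // => ->; rewrite mxE.
Qed.

Lemma row_agrees (x : 'rV[K]_r) (b : 'rV[K]_n) :
  x *m Q = colsub (fun j => enum_val (cast_ord eqAB j)) b ->
  forall j, j \in B -> (x *m col j Y) 0 0 = b 0 j.
Proof.
move=> + j jB => /(congr1 (fun z : 'rV[K]_#|A| => z 0 (cast_ord (esym eqAB) (enum_rank_in jB j)))).
rewrite mulmx_colsub mxE [RHS]mxE cast_ordKV enum_rankK_in // => <-.
by rewrite -col_mulmx mxE.
Qed.

Lemma extend_col w : exists y : 'cV[K]_r, forall i, i \in A -> (row i X *m y) 0 0 = M i w.
Proof.
have [y Py] := solve_col block_unit (rowsub (@enum_val _ (mem A)) (col w M)).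
by exists y => i iA; rewrite (col_agrees Py iA) mxE.
Qed.

Lemma extend_row v : exists x : 'rV[K]_r, forall j, j \in B -> (x *m col j Y) 0 0 = M v j.
Proof.
have [x Qx] := solve_row block_unit (colsub (fun j => enum_val (cast_ord eqAB j)) (row v M)).
by exists x => j jB; rewrite (row_agrees Qx jB) mxE.
Qed.

Lemma extend_corner v w : (#|A| < r)%N -> exists (x : 'rV[K]_r) (y : 'cV[K]_r),
  [/\ forall i, i \in A -> (row i X *m y) 0 0 = M i w,
      forall j, j \in B -> (x *m col j Y) 0 0 = M v j & (x *m y) 0 0 = M v w].
Proof.
move=> Ar.
have [x [y [Py Qx xy]]] := solve_corner block_unit
   (rowsub (@enum_val _ (mem A)) (col w M))
   (colsub (fun j => enum_val (cast_ord eqAB j)) (row v M)) (M v w) Ar.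
exists x, y; split=> [i iA|j jB|].
- by rewrite (col_agrees Py iA) mxE.
- by rewrite (row_agrees Qx jB) mxE.
- by rewrite xy mxE eqxx mulr1n.
Qed.
End Block.

Lemma subset_of_size (T : finType) (A : {set T}) k : (k <= #|A|)%N ->
  exists2 B : {set T}, B \subset A & #|B| = k.
Proof.
move=> kA; exists [set x in take k (enum A)].
  by apply/fintype.subsetP => x; rewrite inE => /mem_take; rewrite mem_enum.
rewrite cardsE (card_uniqP _) ?take_uniq ?enum_uniq // size_takel //.
by rewrite -cardE.
Qed.

(** The bound on the bicliques is used only when both ends of the bisimplicial
    edge have the same degree, to make room for [extend_corner]. *)
Theorem chordal_factorization G M : bipartite_chordal G -> generic_on G M ->
    (forall (A : {set 'I_m}) (B : {set 'I_n}), #|A| = #|B| ->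
      finset.setX A B \subset G -> (#|A| <= r)%N) ->
  exists X Y, factors_on G M X Y.
Proof.
have [N] := ubnP #|G|; elim: N G => // N IH G sG chordalG genM small.
have [G0|[e0 e0G]] := set_0Vmem G.
  by exists 0, 0 => i j; rewrite G0 inE.
have [v [w [vw bis]]] := bisimplicial_edge chordalG e0G.
pose Nw := [set i | (i, w) \in G]; pose Nv := [set j | (v, j) \in G].
have vNw : v \in Nw by rewrite inE.
have wNv : w \in Nv by rewrite inE.
have NN : finset.setX Nw Nv \subset G.
  by apply/fintype.subsetP => -[i j]; rewrite !inE => /andP[/= iw vj]; exact: bis.
have IHG (A : {set 'I_m}) (B : {set 'I_n}) : (v \notin A) || (w \notin B) ->
    exists X Y, factors_on (restrict G A B) M X Y.
  move=> AB; have subG : restrict G A B \subset G by apply: finset.subsetIl.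
  apply: IH.
  - rewrite ltnS in sG; apply: leq_trans sG; apply/proper_card/properP; split=> //.
    by exists (v, w); rewrite // in_restrict vw /= negb_and.
  - exact: chordal_restrict.
  - by move=> A' B' e sAB; apply: genM; apply: fintype.subset_trans sAB _.
  - by move=> A' B' e sAB; apply: small e _; apply: fintype.subset_trans sAB _.
have genR (A : {set 'I_m}) (B : {set 'I_n}) : generic_on (restrict G A B) M.
  by move=> A' B' e sAB; apply: genM; apply: fintype.subset_trans sAB (finset.subsetIl _ _).
have [ab|ba|ab] := ltngtP #|Nw| #|Nv|.
- have [X [Y XY]] : exists X Y, factors_on (restrict G [set: 'I_m]%SET (~: [set w])) M X Y.
    by apply: IHG; rewrite !inE eqxx orbT.
  have [B BN sB] : exists2 B : {set 'I_n}, B \subset Nv :\ w & #|B| = #|Nw|.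
    by apply: subset_of_size; rewrite (cardsD1 w) wNv in ab.
  have [|y yE] := @extend_col _ M X Y Nw B (esym sB) XY _ (@genR _ _) w.
    apply/fintype.subsetP => -[i j]; rewrite finset.in_setX => /andP[/= iN jB].
    have := fintype.subsetP BN _ jB; rewrite in_restrict !inE => /andP[jw vj].
    by rewrite jw bis //; rewrite inE in iN.
  exists X, (with_col Y w y) => i j ij; rewrite mulmx_rowcol col_with_col.
  have [jw|jw] := eqVneq j w; first by rewrite jw yE // inE -jw.
  by rewrite -mulmx_rowcol XY // in_restrict ij !inE.
- have [X [Y XY]] : exists X Y, factors_on (restrict G (~: [set v]) [set: 'I_n]%SET) M X Y.
    by apply: IHG; rewrite !inE eqxx.
  have [A AN sA] : exists2 A : {set 'I_m}, A \subset Nw :\ v & #|A| = #|Nv|.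
    by apply: subset_of_size; rewrite (cardsD1 v) vNw in ba.
  have [|x xE] := @extend_row _ M X Y A Nv sA XY _ (@genR _ _) v.
    apply/fintype.subsetP => -[i j]; rewrite finset.in_setX => /andP[/= iA jN].
    have := fintype.subsetP AN _ iA; rewrite in_restrict !inE => /andP[iv iw].
    by rewrite iv bis //; rewrite inE in jN.
  exists (with_row X v x), Y => i j ij; rewrite mulmx_rowcol row_with_row.
  have [iv|iv] := eqVneq i v; first by rewrite iv xE // inE -iv.
  by rewrite -mulmx_rowcol XY // in_restrict ij !inE iv.
- have [X [Y XY]] : exists X Y,
      factors_on (restrict G (~: [set v]) (~: [set w])) M X Y.
    by apply: IHG; rewrite !inE eqxx.
  have eqAB : #|Nw :\ v| = #|Nv :\ w|.
    by move: ab; rewrite (cardsD1 v) (cardsD1 w) vNw wNv => -[].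
  have [||x [y [yE xE xy]]] := @extend_corner _ M X Y _ _ eqAB XY _ (@genR _ _) v w.
  + apply/fintype.subsetP => -[i j].
    rewrite finset.in_setX !inE => /andP[/= /andP[iv iw] /andP[jw vj]].
    by rewrite iv jw bis.
  + by have := small _ _ ab NN; rewrite (cardsD1 v) vNw.
  exists (with_row X v x), (with_col Y w y) => i j ij.
  rewrite mulmx_rowcol row_with_row col_with_col.
  have [iv|iv] := eqVneq i v; have [jw|jw] := eqVneq j w.
  + by rewrite iv jw.
  + by rewrite iv xE // !inE jw -iv.
  + by rewrite jw yE // !inE iv -jw.
  + by rewrite -mulmx_rowcol XY // in_restrict ij !inE iv jw.
Qed.
End Factorization.

(** * Nonvanishing of polynomials *)

Import -(notations) mpoly.

Lemma few_roots (K : numDomainType) (q : {poly K}) (f : nat -> K) :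
  q != 0 -> injective f -> exists k, ~~ root q (f k).
Proof.
move=> q0 finj; apply: contrapT => all_roots.
have := @max_poly_roots _ q (map f (iota 0 (size q))) q0.
rewrite size_map size_iota ltnn map_inj_uniq // iota_uniq => h.
suff /h /(_ isT) : all (root q) (map f (iota 0 (size q))) by [].
apply/allP => _ /mapP[k _ ->]; apply: contrapT => nr.
by apply: all_roots; exists k; apply/negP.
Qed.

Lemma natr_inj (K : numDomainType) : injective (fun k => k%:R : K).
Proof. by move=> k l /eqP; rewrite eqr_nat => /eqP. Qed.

Section Line.
Variables (K : numDomainType) (d : nat).
Implicit Types (p : mpoly d K) (u v : 'rV[K]_d).

Definition nonvanishing p v := meval (fun i => v 0 i) p != 0.

Lemma meval_line p u v : exists q : {poly K}, forall t,
  q.[t] = meval (fun i => (u + t *: v) 0 i) p.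
Proof.
exists (\sum_(m <- msupp p) mcoeff m p *: \prod_i ((u 0 i)%:P + (v 0 i)%:P * 'X) ^+ m i).
move=> t; rewrite mevalE horner_sum; apply: eq_bigr => m _.
rewrite hornerZ horner_prod; congr (_ * _); apply: eq_bigr => i _.
by rewrite horner_exp !hornerE !mxE mulrC.
Qed.

(** The sequence f is arbitrary: for density it will tend to 0. *)
Lemma nonvanishing_near p u v (f : nat -> K) : nonvanishing p v -> injective f ->
  exists k, nonvanishing p (u + f k *: (v - u)).
Proof.
move=> pv finj; have [q qE] := meval_line p u (v - u).
have q0 : q != 0.
  apply: contraNneq pv => q0; have := qE 1; rewrite q0 horner0 scale1r addrC subrK.
  by move=> <-.
by have [k] := few_roots q0 finj; rewrite /root qE; exists k.
Qed.

(** On the line joining the two points, each polynomial has finitely many roots. *)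
Lemma nonvanishing_mul p p' : (exists v, nonvanishing p v) ->
  (exists v, nonvanishing p' v) -> exists v, nonvanishing (p * p') v.
Proof.
move=> [v pv] [v' pv'].
have [q qE] := meval_line p v (v' - v); have [q' qE'] := meval_line p' v (v' - v).
have q0 : q != 0.
  apply: contraNneq pv => q0; have := qE 0; rewrite q0 horner0 scale0r addr0.
  by move=> <-.
have q'0 : q' != 0.
  apply: contraNneq pv' => q'0; have := qE' 1; rewrite q'0 horner0 scale1r addrC subrK.
  by move=> <-.
have qq0 : q * q' != 0 by rewrite mulf_neq0.
have [k] := few_roots qq0 (@natr_inj K).
rewrite rootM negb_or /root qE qE' => /andP[h h'].
by exists (v + k%:R *: (v' - v)); rewrite /nonvanishing mevalM mulf_neq0.
Qed.
End Line.

(** * The specified minors as polynomials *)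

Section MinorPolynomials.
Variables (K : numFieldType) (m n : nat) (G : bigraph m n).

(** The coordinates of [entry], with the same value 0 off the edges. *)
Definition edge_var i j : mpoly #|G| K :=
  if [pick k : 'I_(#|G|) | enum_val k == (i, j)] is Some k then mpolyX K (mnm1 k) else 0.

Definition minor_poly (A : {set 'I_m}) (B : {set 'I_n}) (eqAB : #|A| = #|B|) :=
  \det (submatrix (\matrix_(i, j) edge_var i j) eqAB).

Definition minors_prod : mpoly #|G| K :=
  \prod_(A : {set 'I_m}) \prod_(B : {set 'I_n} | finset.setX A B \subset G)
    (if #|A| =P #|B| is ReflectT eqAB then minor_poly eqAB else 1).

Lemma meval_minor (M : pmatrix G K) (A : {set 'I_m}) (B : {set 'I_n}) (eqAB : #|A| = #|B|) :
  meval (fun k => M 0 k) (minor_poly eqAB) = minor M eqAB.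
Proof.
rewrite -det_map_mx; congr (\det _); apply/matrixP => i j; rewrite !mxE /edge_var /entry.
by case: pickP => [k _|_]; [exact: mevalXU|exact: meval0].
Qed.

Lemma entry_edge (M : pmatrix G K) i j (ij : (i, j) \in G) :
  entry M i j = M 0 (enum_rank_in ij (i, j)).
Proof.
rewrite /entry; case: pickP => [k /eqP kE|/(_ (enum_rank_in ij (i, j)))].
  by congr (M 0 _); apply: enum_val_inj; rewrite kE enum_rankK_in.
by rewrite enum_rankK_in // eqxx.
Qed.

Lemma minor_poly_nonvanishing (A : {set 'I_m}) (B : {set 'I_n}) (eqAB : #|A| = #|B|) :
  finset.setX A B \subset G -> exists M, nonvanishing (minor_poly eqAB) M.
Proof.
move=> sAB.
(* the increasing bijection from A to B, whose block is the identity *)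
pose f (e : 'I_m * 'I_n) : K := (index e.1 (enum A) == index e.2 (enum B))%:R.
exists (\row_k f (enum_val k)); rewrite /nonvanishing meval_minor /minor.
rewrite (_ : (\matrix_(_, _) _) = 1%:M) ?det1 ?oner_neq0 //.
apply/matrixP => i j; rewrite !mxE.
have ij : (enum_val i, enum_val (cast_ord eqAB j)) \in G.
  by apply: (fintype.subsetP sAB); rewrite inE !enum_valP.
rewrite (entry_edge _ ij) mxE enum_rankK_in // /f /=.
have index_enum (T : finType) (S : {set T}) (k : 'I_#|S|) : index (enum_val k) (enum S) = k.
  by rewrite (enum_val_nth (enum_val k)) index_uniq ?enum_uniq // -cardE.
by rewrite !index_enum.
Qed.

Lemma minors_prod_nonvanishing : exists M, nonvanishing minors_prod M.
Proof.
have one : exists M, nonvanishing (1 : mpoly #|G| K) M.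
  by exists 0; rewrite /nonvanishing meval1 oner_neq0.
apply: (big_ind (fun p => exists M, nonvanishing p M)) => //; first exact: nonvanishing_mul.
move=> A _; apply: (big_ind (fun p => exists M, nonvanishing p M)) => //.
  exact: nonvanishing_mul.
by move=> B sAB; case: eqP => // eqAB; exact: minor_poly_nonvanishing.
Qed.

Lemma minors_prod_specified M : nonvanishing minors_prod M -> specified_minors_nonzero M.
Proof.
move=> + A B eqAB sAB; apply: contraNneq => minor0.
rewrite rmorph_prod (bigD1 A) //= rmorph_prod (bigD1 B) //=.
case: eqP => // eqAB'; rewrite (eq_irrelevance eqAB' eqAB) meval_minor minor0.
by rewrite !mul0r.
Qed.
End MinorPolynomials.

(** * Bicliques as pairs of sets *)

Section Bicliques.
Variables (m n : nat) (G : bigraph m n).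

Definition has_biclique r := exists (A : {set 'I_m}) (B : {set 'I_n}),
  [/\ #|A| = r, #|B| = r & finset.setX A B \subset G].

(** An embedding of a nonempty biclique sends each side into one side of G, but it
    may exchange the two sides. *)
Lemma contains_bicliqueP r : contains_induced G (biclique r) <-> has_biclique r.
Proof.
split; last first.
  move=> [A [B [sA sB /fintype.subsetP AB]]].
  exists (fun a => match a with
    | inl i => inl (enum_val (cast_ord (esym sA) i))
    | inr j => inr (enum_val (cast_ord (esym sB) j)) end).
    by case=> [i|j] [i'|j'] // [] /enum_val_inj /cast_ord_inj ->.
  by case=> [i|j] [i'|j'] //=; rewrite finset.in_setT AB // inE !enum_valP.
case=> f finj fadj.
case: r f finj fadj => [|r] f finj fadj.
  exists finset.set0, finset.set0; rewrite !cards0; split=> //.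
  by apply/fintype.subsetP => -[i j]; rewrite !inE.
have adjf i j : adj G (f (inl i)) (f (inr j)) by rewrite fadj /= finset.in_setT.
have card_sep (T : finType) (g : 'I_r.+1 -> 'I_m + 'I_n) (h : T -> 'I_m + 'I_n) :
    injective g -> (forall i, exists a, g i = h a) ->
    exists2 A : {set T}, #|A| = r.+1 & forall a, a \in A -> exists i, g i = h a.
  move=> ginj gh; have [k kE] := choice gh; exists (k @: 'I_r.+1).
    rewrite card_imset ?card_ord // => i i' ii'; apply: ginj; by rewrite !kE ii'.
  by move=> a /imsetP[i _ ->]; exists i.
have inlf : injective (fun i => f (inl i)) by move=> i i' /finj [].
have inrf : injective (fun i => f (inr i)) by move=> i i' /finj [].
case f0: (f (inl ord0)) => [a|a].
  have fr j : exists b, f (inr j) = inr b.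
    by have := adjf ord0 j; rewrite f0; case: (f (inr j)) => // b _; exists b.
  have fl i : exists b, f (inl i) = inl b.
    by have := adjf i ord0; have [b ->] := fr ord0; case: (f (inl i)) => // c _; exists c.
  have [A sA fA] := card_sep _ _ _ inlf fl; have [B sB fB] := card_sep _ _ _ inrf fr.
  exists A, B; split=> //; apply/fintype.subsetP => -[i j]; rewrite inE => /andP[].
  move=> /fA[k kE] /fB[l lE]; by have := adjf k l; rewrite kE lE.
have fr j : exists b, f (inr j) = inl b.
  by have := adjf ord0 j; rewrite f0; case: (f (inr j)) => // b _; exists b.
have fl i : exists b, f (inl i) = inr b.
  by have := adjf i ord0; have [b ->] := fr ord0; case: (f (inl i)) => // c _; exists c.
have [B sB fB] := card_sep _ _ _ inlf fl; have [A sA fA] := card_sep _ _ _ inrf fr.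
exists A, B; split=> //; apply/fintype.subsetP => -[i j]; rewrite inE => /andP[].
move=> /fA[k kE] /fB[l lE]; by have := adjf l k; rewrite kE lE.
Qed.

Lemma largest_bicliqueP : exists r, has_biclique r /\ forall s, has_biclique s -> (s <= r)%N.
Proof.
have ex0 : exists r, `[< has_biclique r >].
  exists 0%N; apply/asboolP; exists finset.set0, finset.set0; rewrite !cards0; split=> //.
  by apply/fintype.subsetP => -[i j]; rewrite !inE.
have bound r : `[< has_biclique r >] -> (r <= m)%N.
  by move=> /asboolP[A [_ [<- _ _]]]; rewrite -[m in (_ <= m)%N]card_ord max_card.
case: (ex_maxnP ex0 bound) => r /asboolP rG rmax; exists r; split=> // s sG.
exact/rmax/asboolP.
Qed.
End Bicliques.

(** * Completion ranks *)

Section CompletionRank.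
Variables (K : fieldType) (m n : nat) (G : bigraph m n) (r : nat) (M : pmatrix G K).
Hypotheses (chordalG : bipartite_chordal G) (rG : has_biclique G r).
Hypothesis rmax : forall s, has_biclique G s -> (s <= r)%N.
Hypothesis genM : specified_minors_nonzero M.

Lemma completion_rank_ge A : completion M A -> (r <= \rank A)%N.
Proof.
move=> MA; have [I [J [sI sJ IJ]]] := rG; have eqIJ : #|I| = #|J| by rewrite sI.
have := genM eqIJ IJ; rewrite -unitfE -unitmxE -row_free_unit => /eqP rk.
rewrite -sI -rk.
set f := (fun j : 'I_#|I| => enum_val (cast_ord eqIJ j)).
have -> : \matrix_(i, j) entry M (enum_val i) (enum_val (cast_ord eqIJ j)) =
    rowsub (@enum_val _ (mem I)) (1%:M *m A *m colsub f 1%:M).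
  rewrite mul1mx mulmx_colsub mulmx1; apply/matrixP => i j; rewrite !mxE MA //.
  by apply: (fintype.subsetP IJ); rewrite inE !enum_valP.
rewrite -!mul_rowsub_mx; apply: leq_trans (mxrankM_maxl _ _) _.
exact: mxrankM_maxr.
Qed.

Lemma chordal_completion_rank : completion_rank M r.
Proof.
split; last exact: completion_rank_ge.
have [|A B eqAB sAB|X [Y XY]] := @chordal_factorization _ _ _ r G
    (\matrix_(i, j) entry M i j) chordalG.
- move=> A B eqAB sAB; have := genM eqAB sAB; rewrite /minor.
  by congr (\det _ != 0); apply/matrixP => i j; rewrite !mxE.
- by apply: rmax; exists A, B.
have MA : completion M (X *m Y) by move=> i j /XY ->; rewrite mxE.
exists (X *m Y) => //; apply/eqP; rewrite eqn_leq completion_rank_ge // andbT.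
by apply: leq_trans (mxrankM_maxl _ _) (rank_leq_col _).
Qed.
End CompletionRank.

Lemma completion_rank_uniq (K : fieldType) m n (G : bigraph m n) (M : pmatrix G K) r s :
  completion_rank M r -> completion_rank M s -> r = s.
Proof.
move=> [[A MA <-] minA] [[B MB <-] minB].
by apply/eqP; rewrite eqn_leq minA // minB.
Qed.

(** A nonempty Zariski-open set contains a nonempty principal one, and two
    nonempty principal ones meet. *)
Lemma generic_rank_uniq (R : realType) m n (G : bigraph m n) r s :
  generic_completion_rank R G r -> generic_completion_rank R G s -> r = s.
Proof.
have principal t : generic_completion_rank R G t ->
    exists2 p, (exists M, nonvanishing p M) &
      forall M : pmatrix G R[i], nonvanishing p M -> completion_rank M t.
  move=> [U [[S ->] [M [p Sp pM]] Urank]]; exists p; first by exists M.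
  by move=> M' pM'; apply: Urank; exists p.
move=> /principal[p pM pr] /principal[q qM qs].
have [M] := nonvanishing_mul pM qM.
rewrite /nonvanishing mevalM mulf_eq0 negb_or => /andP[pM1 qM1].
exact: completion_rank_uniq (pr _ pM1) (qs _ qM1).
Qed.

Section Euclidean.
Variables (R : realType) (d : nat).
Local Open Scope classical_set_scope.

Lemma continuous_meval (p : mpoly d R) :
  continuous (fun v : 'rV[R]_d => meval (fun i => v 0 i) p).
Proof.
rewrite (_ : (fun _ => _) = fun v : 'rV[R]_d =>
    \sum_(m <- msupp p) mcoeff m p * \prod_(i < d) v 0 i ^+ m i); last first.
  by apply/funext => v; exact: mevalE.
apply: (@continuous_big R^o) => [|m _]; first exact: add_continuous.
move=> v; apply: continuousM; first exact: cst_continuous.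
apply: (@continuous_big R^o) => [|i _]; first exact: mul_continuous.
move=> {}v.
apply: (@continuous_comp _ _ _ (fun u : 'rV[R]_d => u 0 i) (fun x => x ^+ m i)).
  exact: coord_continuous.
exact: exprn_continuous.
Qed.

Lemma nonvanishing_nbhs (p : mpoly d R) (v : 'rV[R]_d) : nonvanishing p v ->
  nbhs v [set u | nonvanishing p u].
Proof.
move=> pv; have := @continuous_meval p v [set x | x != 0]; apply.
exact: (open_nbhs_nbhs (conj (@open_neq R 0) pv)).
Qed.

Lemma nonvanishing_dense (p : mpoly d R) (v : 'rV[R]_d) (O : set 'rV[R]_d) :
    (exists u, nonvanishing p u) -> nbhs v O -> exists2 u, O u & nonvanishing p u.
Proof.
move=> [w pw] vO.
have : nbhs (0 : R) [set t | O (v + t *: (w - v))].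
  have h : {for (0 : R), continuous (fun t : R => v + t *: (w - v))}.
    apply: continuousD; first exact: cst_continuous.
    by apply: continuousZr_tmp; exact: id.
  by apply: h; rewrite /= scale0r addr0.
move=> /nbhs_ballP[e /= e0 eO].
(* these points all lie strictly inside the ball of radius e *)
have finj : injective (fun k => e / k.+2%:R).
  move=> k l /(mulfI (lt0r_neq0 e0)) /invr_inj /eqP; rewrite eqr_nat.
  by move=> /eqP[].
have [k pk] := nonvanishing_near v pw finj.
exists (v + (e / k.+2%:R) *: (w - v)) => //; apply: eO.
rewrite /ball /= sub0r normrN gtr0_norm ?divr_gt0 // ltr_pdivrMr //.
by rewrite ltr_pMr // ltr1n.
Qed.
End Euclidean.

Theorem theorem5p3 (R : realType) (m n : nat) (G : bigraph m n)
    (chordalG : bipartite_chordal G) :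
  (exists! r : nat, generic_completion_rank R G r) /\
  forall gcr : nat, generic_completion_rank R G gcr ->
    [/\ largest_biclique G gcr,
        forall r : nat, typical_completion_rank R G r <-> r = gcr,
        forall M : pmatrix G R, specified_minors_nonzero M ->
          exists2 A, completion M A & mxrank A = gcr
      & forall M : pmatrix G (complex R), specified_minors_nonzero M ->
          exists2 A, completion M A & mxrank A = gcr].
Proof.
have [g [gG gmax]] := largest_bicliqueP G.
have rankG (K : fieldType) (M : pmatrix G K) : specified_minors_nonzero M -> completion_rank M g.
  exact: chordal_completion_rank.
have gcrG : generic_completion_rank R G g.
  exists [set M | nonvanishing (minors_prod (complex R) G) M]%classic; split.
  - exists [set minors_prod (complex R) G]%classic; apply/seteqP; split=> M /=.
      by move=> h; exists (minors_prod (complex R) G).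
    by case=> p ->.
  - exact: minors_prod_nonvanishing.
  - by move=> M /minors_prod_specified; exact: rankG.
split; first by exists g; split=> // r; exact: generic_rank_uniq.
move=> r /(generic_rank_uniq gcrG) <-; split.
- split; first exact/contains_bicliqueP.
  by move=> s /contains_bicliqueP; exact: gmax.
- move=> s; split=> [[M0 M0s]|->].
    have [M Ms] := nonvanishing_dense (minors_prod_nonvanishing R G) M0s.
    by move=> /minors_prod_specified /rankG; exact: completion_rank_uniq.
  have [M Mg] := minors_prod_nonvanishing R G; exists M.
  apply: filterS (nonvanishing_nbhs Mg) => M' /minors_prod_specified; exact: rankG.
- by move=> M /rankG[].
- by move=> M /rankG[].
Qed.
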